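(* Let $X$ be a set. For every hypothesis $\mathcal{H}\subseteq 2^X$, every sample $f:\omega\to X$ and every $n\in\omega$, $$S(\mathcal{H},f,n)+S(\mathcal{H}^c,f,n)\leq 1 .$$
   Context: $2^X$ is the set of functions $X\to\{0,1\}$. A hypothesis is a subset $\mathcal{H}\subseteq 2^X$, and $\mathcal{H}^c=2^X\setminus\mathcal{H}$. A sample of $X$ is an injective function $f:\omega\to X$. Write $[n]=\{0,\dots,n-1\}$. For $X_0\subseteq X$, $\mathcal{H}{\upharpoonright}_{X_0}=\{h{\upharpoonright}_{X_0} : h\in\mathcal{H}\}\subseteq 2^{X_0}$. The surprise of $\mathcal{H}$ along $f$ at stage $n$ is $$S(\mathcal{H},f,n)=1-\frac{|\mathcal{H}{\upharpoonright}_{f([n])}|}{2^{|f([n])|}}.$$ *)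

(* Defs.v *)
From mathcomp Require Export all_boot all_order all_algebra finmap.
From mathcomp Require Export boolp classical_sets functions cardinality reals.

Set Implicit Arguments.
Unset Strict Implicit.
Unset Printing Implicit Defensive.

Local Open Scope classical_set_scope.
Local Open Scope ring_scope.

(* [fset_set] sends infinite sets to the empty one, so this is the cardinality
   only of finite sets. *)
Definition card_of (T : Type) (A : set T) : nat :=
  #|` fset_set (A : set {classic T}) |%fset.

Definition restriction (X : Type) (H : set (X -> bool)) (X0 : set X) :
    set (X0 -> bool) :=
  [set sigL X0 h | h in H].
Arguments restriction {X} H X0 _.

(* Both cardinalities are taken of finite sets: [f @` `I_n] has at most [n]
   elements, and the restriction lives among the functions from it to [bool]. *)
Definition surprise (R : realType) (X : Type) (H : set (X -> bool))
    (f : nat -> X) (n : nat) : R :=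
  1 - (card_of (restriction H (f @` `I_n)))%:R
      / 2%:R ^+ card_of (f @` `I_n).

(* Main.v *)
Require Import Defs.
From mathcomp Require Import lra.
Import GRing.Theory Num.Theory.

(** Write [A] for the set of the first [n] sample points.  Every function
    [A -> bool] extends to [X], and the extension lies in [H] or in its
    complement; hence the restrictions of [H] and of [~` H] to [A] together
    exhaust [A -> bool] ([restriction_setC]).  As there are [2 ^ #A] such
    functions ([card_of_functions]) and the cardinality of a union is at most
    the sum of the cardinalities ([card_of_union]), the two fractions
    subtracted in the surprises add up to at least [1], so the two surprises
    add up to at most [2 - 1 = 1]. *)

Local Open Scope classical_set_scope.
Local Open Scope ring_scope.

Lemma card_of_union (T : Type) (A B : set T) : finite_set A -> finite_set B ->
  (card_of (A `|` B) <= card_of A + card_of B)%N.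
Proof.
move=> finA finB; rewrite /card_of (@fset_setU {classic T})// cardfsU.
exact: leq_subr.
Qed.

Lemma card_of_range (T : finType) (U : Type) (g : T -> U) : injective g ->
  card_of (range g) = #|T|.
Proof.
move=> g_inj.
rewrite /card_of (@fset_set_image _ {classic U}); last exact: finite_finset.
have -> : fset_set [set: T] = [fset x | x in T]%fset.
  apply/fsetP => x; rewrite in_fset_set; last exact: finite_finset.
  by rewrite !inE; apply/idP; rewrite inE.
by rewrite card_imfset// card_imfset// -cardE.
Qed.

(** [A -> bool] has no canonical finite type structure, as [A] is finite only
    propositionally.  Choosing an enumeration of [A] as a finite type transfers
    both finiteness and the count of functions from [{ffun F -> bool}]. *)
Lemma range_of_ffun (T : Type) (A : set T) : finite_set A ->
  exists F : finType, exists2 g : {ffun F -> bool} -> (A -> bool),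
    injective g /\ range g = setT & #|F| = card_of A.
Proof.
move=> finA; pose F := fset_set (A : set {classic T}).
have inF (a : A) : (val a : {classic T}) \in F.
  by rewrite in_fset_set//; exact: valP a.
have inA (x : F) : (val x : T) \in A.
  by have : val x \in F := valP x; rewrite in_fset_set.
exists F; exists (fun u a => u [` inF a]%fset); last by rewrite -cardfE.
split=> [u v uv|].
  apply/ffunP => x; have := congr1 (@^~ (SigSub (inA x))) uv => /=.
  by congr (u _ = v _); exact: val_inj.
rewrite -subTset => h _; exists [ffun x : F => h (SigSub (inA x))] => //.
by apply/funext => a; rewrite ffunE; congr h; exact: val_inj.
Qed.

Lemma finite_functions (T : Type) (A : set T) : finite_set A ->
  finite_set [set: A -> bool].
Proof.
move=> /range_of_ffun[F [g [_ <-] _]]; exact/finite_image/finite_finset.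
Qed.

Lemma card_of_functions (T : Type) (A : set T) : finite_set A ->
  card_of [set: A -> bool] = (2 ^ card_of A)%N.
Proof.
move=> /range_of_ffun[F [g [g_inj <-] <-]].
by rewrite card_of_range// card_ffun card_bool.
Qed.

(** Restriction of functions from [X] to [A] is surjective: a function on [A]
    extends by the constant [false] outside [A]. *)
Lemma restriction_setC (X : Type) (H : set (X -> bool)) (A : set X) :
  restriction H A `|` restriction (~` H) A = setT.
Proof. by rewrite /restriction -image_setU setUv; exact: (image_sigL false). Qed.

Theorem proposition1p1 (R : realType) (X : Type) (H : set (X -> bool))
    (f : nat -> X) (f_inj : injective f) (n : nat) :
  surprise R H f n + surprise R (~` H) f n <= 1.
Proof.
rewrite /surprise; set A := f @` `I_n.
have finA : finite_set A by exact/finite_image/finite_II.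
have fin K : finite_set (restriction K A).
  by apply: (sub_finite_set (@subsetT _ _)); exact: finite_functions.
have := card_of_union _ _ _ (fin H) (fin (~` H)).
rewrite restriction_setC card_of_functions// -(ler_nat R) natrD natrX => le2.
have : 1 <= ((card_of (restriction H A))%:R
             + (card_of (restriction (~` H) A))%:R) / 2%:R ^+ card_of A :> R.
  by rewrite ler_pdivlMr ?mul1r// exprn_gt0.
rewrite mulrDl; lra.
Qed.
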